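(* Let $n\ge m\ge k\ge1$ be integers. If $A$ is an entrywise nonnegative $m\times n$ matrix, then $$\|A\|_{F_k}\le\frac12\left(1+\sqrt{k}\right)\sqrt{mn}\,|A|_\infty.$$ For $A\neq0$, equality holds if and only if $A$ is a scalar multiple of a $(0,1)$-matrix, and the matrix $2A-|A|_\infty J_{m,n}$ is plain and has exactly $k$ nonzero singular values, which are all equal.
   Context: For an $m\times n$ complex matrix $A=[a_{ij}]$, $\sigma_1(A)\ge\cdots\ge\sigma_m(A)$ are its singular values (square roots of the eigenvalues of $AA^*$), $\|A\|_{F_k}=\sigma_1(A)+\cdots+\sigma_k(A)$ is the Ky Fan $k$-norm, and $|A|_\infty=\max_{i,j}|a_{ij}|$. $J_{m,n}$ is the $m\times n$ all-ones matrix. An $m\times n$ matrix $B$ is called plain if the all-ones vectors $\mathbf{j}_m\in\mathbb{R}^m$ and $\mathbf{j}_n\in\mathbb{R}^n$ are singular vectors to $\sigma_1(B)$, that is, $\sigma_1(B)=\langle \mathbf{j}_m,B\mathbf{j}_n\rangle/\sqrt{mn}$. *)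

(* Defs.v *)
From HB Require Import structures.
From mathcomp Require Import all_boot all_order all_algebra.
From mathcomp Require Import reals complex.

Set Implicit Arguments.
Unset Strict Implicit.
Unset Printing Implicit Defensive.

Import Order.TTheory GRing.Theory Num.Theory.
Import ComplexField.Normc.

Local Open Scope ring_scope.
Local Open Scope complex_scope.
Local Open Scope sesquilinear_scope.

Section Definitions.
Variable R : realType.
Implicit Types m n k : nat.

(* Each eigenvalue is listed with its algebraic multiplicity. *)
Definition eigenvalues n (M : 'M[R[i]]_n) : seq R[i] :=
  sval (closed_field_poly_normal (char_poly M)).

(* Here [A ^t*] is the conjugate transpose.  The eigenvalues of [A *m A ^t*]
   are nonnegative reals, so that taking real parts loses nothing. *)
Definition singular_values m n (A : 'M[R[i]]_(m, n)) : seq R :=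
  sort >=%R [seq Num.sqrt (complex.Re z) | z <- eigenvalues (A *m A ^t*)].

(* Indices start at 0: [sigma A 0] is the largest singular value. *)
Definition sigma m n (A : 'M[R[i]]_(m, n)) (i : nat) : R :=
  (singular_values A)`_i.

Definition ky_fan_norm k m n (A : 'M[R[i]]_(m, n)) : R :=
  \sum_(i < k) sigma A i.

Definition max_norm m n (A : 'M[R[i]]_(m, n)) : R :=
  \big[Num.max/0]_(ij : 'I_m * 'I_n) normc (A ij.1 ij.2).

Definition all_ones m n : 'M[R[i]]_(m, n) := const_mx 1.

(* [(all_ones 1 m *m B *m all_ones n 1) 0 0] is the inner product of j_m and
   [B j_n]. *)
Definition plain m n (B : 'M[R[i]]_(m, n)) : Prop :=
  (sigma B 0)%:C =
    (all_ones 1 m *m B *m all_ones n 1) 0 0 / (Num.sqrt (m * n)%:R)%:C.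

Definition zero_one_mx m n (B : 'M[R[i]]_(m, n)) : Prop :=
  forall i j, B i j = 0 \/ B i j = 1.

(* The count is with multiplicity. *)
Definition has_exactly_k_nonzero_singular_values k m n
    (B : 'M[R[i]]_(m, n)) : Prop :=
  count (fun s => s != 0) (singular_values B) = k.

Definition nonzero_singular_values_equal m n (B : 'M[R[i]]_(m, n)) : Prop :=
  {in singular_values B &, forall s t, s != 0 -> t != 0 -> s = t}.

End Definitions.

Arguments all_ones {R} m n.

(* Main.v *)
(** Put [M = |A|_oo] and [D = 2A - MJ], and pair matrices by
    [<X, Y> = Re tr(Y^* X)].  Truncating the polar factor of [A] to its [k]
    largest singular values yields [W] such that [W W^*] is a projection,
    [|W|^2 <= k] and [<A, W> = ||A||_{F_k}], so that
    [2 ||A||_{F_k} = <D, W> + M <J, W>].  Here [<D, W> <= sqrt(k mn) M] by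
    Cauchy-Schwarz and [<J, W> <= sqrt(mn)] since [W] is a contraction.
    Equality forces [D] to be a multiple of [W] and all its entries to be
    [M] or [-M], whence the conditions on [D].

    Conversely, under these conditions [D = sW] with [Q = W W^*] a projection,
    and plainness makes the all-ones vector a fixed vector of [Q].  Then
    [A A^*] is the square of the positive matrix
    [S = (s/2) Q + (M sqrt(mn) / 2m) J_{m,m}], whose rank is at most [k], so
    [||A||_{F_k} = tr S]. *)
Require Import Defs.
From HB Require Import structures.
From mathcomp Require Import all_boot all_order all_algebra all_fingroup.
From mathcomp Require Import reals complex ring lra.

Set Implicit Arguments.
Unset Strict Implicit.
Unset Printing Implicit Defensive.

Import Order.TTheory GRing.Theory Num.Theory.
Import ComplexField.Normc.

Local Open Scope ring_scope.
Local Open Scope complex_scope.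
Local Open Scope sesquilinear_scope.

(** * Characteristic polynomials under similarity, and the rank of a diagonal matrix *)

Lemma char_poly_conj (F : fieldType) n (P M : 'M[F]_n) :
  P \in unitmx -> char_poly (invmx P *m M *m P) = char_poly M.
Proof.
move=> Pu; pose Pp : 'M[{poly F}]_n := map_mx (@polyC F) P.
have PpV : map_mx (@polyC F) (invmx P) *m Pp = 1%:M.
  by rewrite -map_mxM mulVmx // map_mx1.
rewrite /char_poly /char_poly_mx.
have -> : 'X%:M - map_mx (@polyC F) (invmx P *m M *m P)
    = map_mx (@polyC F) (invmx P) *m ('X%:M - map_mx (@polyC F) M) *m Pp.
  rewrite mulmxBr mulmxBl -!map_mxM; congr (_ - _).
  by rewrite mul_mx_scalar -scalemxAl PpV scalemx1.
by rewrite !det_mulmx mulrAC -det_mulmx PpV det1 mul1r.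
Qed.

Lemma rank_diag_mx (F : fieldType) n (d : 'rV[F]_n) :
  \rank (diag_mx d) = (\sum_i (d 0%R i != 0%R))%N.
Proof.
elim: n d => [|n IHn] d; first by rewrite flatmx0 mxrank0 big_ord0.
rewrite -{1}[d](@hsubmxK _ 1 1 n) (@diag_mx_row _ n 1).
rewrite (@rank_diag_block_mx _ 1 1 n n) IHn big_ord_recl; congr addn.
  have -> : d 0 ord0 = @lsubmx F 1 1 n d 0 0.
    by rewrite mxE; congr (d _ _); apply/val_inj.
  rewrite rank_rV; congr nat_of_bool; congr negb.
  apply/eqP/eqP => [/matrixP/(_ 0 0)|E].
    by rewrite !mxE eqxx mulr1n.
  by apply/matrixP => i j; rewrite [LHS]mxE !ord1 E mul0rn mxE.
apply: eq_bigr => i _; rewrite mxE; congr (d _ _ != _).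
exact/val_inj.
Qed.

(** * Conjugate transposes and unitary conjugation *)

Section Adjoint.
Variable C : numClosedFieldType.
Implicit Types m n : nat.

Lemma adjointM m n p (X : 'M[C]_(m, n)) (Y : 'M[C]_(n, p)) :
  (X *m Y)^t* = Y^t* *m X^t*.
Proof. by rewrite trmx_mul map_mxM. Qed.

Lemma gram_adj m n (X : 'M[C]_(m, n)) : (X *m X^t*)^t* = X *m X^t*.
Proof. by rewrite adjointM trmxCK. Qed.

Lemma gram_mull m n p (X : 'M[C]_(p, m)) (Y : 'M[C]_(m, n)) :
  (X *m Y) *m (X *m Y)^t* = X *m (Y *m Y^t*) *m X^t*.
Proof. by rewrite adjointM !mulmxA. Qed.

Lemma adj_conj_adj m (U D : 'M[C]_m) :
  D^t* = D -> (U^t* *m D *m U)^t* = U^t* *m D *m U.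
Proof. by move=> Dh; rewrite !adjointM Dh trmxCK mulmxA. Qed.

Lemma adj_conjM m (U X Y : 'M[C]_m) : U \is unitarymx ->
  (U^t* *m X *m U) *m (U^t* *m Y *m U) = U^t* *m (X *m Y) *m U.
Proof.
by move=> Uu; rewrite !mulmxA -(mulmxA (U^t* *m X) U) (unitarymxP Uu) mulmx1.
Qed.

Lemma adj_conjK m (U D : 'M[C]_m) : U \is unitarymx ->
  U *m (U^t* *m D *m U) *m U^t* = D.
Proof.
move=> Uu; rewrite !mulmxA (unitarymxP Uu) mul1mx -mulmxA (unitarymxP Uu).
by rewrite mulmx1.
Qed.

Lemma tr_adj_conj m (U D : 'M[C]_m) : U \is unitarymx ->
  \tr (U^t* *m D *m U) = \tr D.
Proof. by move=> Uu; rewrite mxtrace_mulC mulmxA (unitarymxP Uu) mul1mx. Qed.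

Lemma rank_adj_conj m (U D : 'M[C]_m) : U \is unitarymx ->
  \rank (U^t* *m D *m U) = \rank D.
Proof.
move=> Uu; have Uf : U \in unitmx := unitarymx_unit Uu.
rewrite mxrankMfree ?row_free_unit // eqmxMfull // row_full_unit
  unitarymx_unit //.
by rewrite trmxC_unitary.
Qed.

End Adjoint.

(** * Singular values read off a unitary diagonalisation *)

Section SingularValues.
Variable R : realType.
Implicit Types m n k : nat.
Local Notation C := R[i].

(** The diagonal is kept as a function into [R], so that order and square roots apply to it
    directly. *)
Definition real_diag n (d : 'I_n -> R) : 'M[C]_n :=
  diag_mx (\row_i (d i)%:C).

Lemma real_diagM n (d e : 'I_n -> R) :
  real_diag d *m real_diag e = real_diag (fun i => d i * e i).
Proof.
rewrite mulmx_diag; congr diag_mx; apply/rowP => i.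
by rewrite !mxE rmorphM.
Qed.

Lemma eq_real_diag n (d e : 'I_n -> R) : d =1 e -> real_diag d = real_diag e.
Proof. by move=> de; congr diag_mx; apply/rowP => i; rewrite !mxE de. Qed.

Lemma scale_real_diag n (a : R) (d : 'I_n -> R) :
  a%:C *: real_diag d = real_diag (fun i => a * d i).
Proof.
by rewrite -linearZ; congr diag_mx; apply/rowP => i; rewrite !mxE rmorphM.
Qed.

Lemma real_diag_adj n (d : 'I_n -> R) : (real_diag d)^t* = real_diag d.
Proof.
apply/matrixP => i j; rewrite !mxE eq_sym; case: eqP => [->|_].
  by rewrite !mulr1n; exact: conjc_real.
by rewrite !mulr0n rmorph0.
Qed.

Lemma tr_real_diag n (d : 'I_n -> R) : \tr (real_diag d) = (\sum_i d i)%:C.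
Proof. by rewrite mxtrace_diag rmorph_sum; apply: eq_bigr => i _;
  rewrite mxE. Qed.

Lemma adjointZ m n (a : R) (X : 'M[C]_(m, n)) : (a%:C *: X)^t* = a%:C *: X^t*.
Proof. by apply/matrixP => i j; rewrite !mxE rmorphM; congr (_ * _);
  exact: conjc_real. Qed.

(** Conjugation preserves the characteristic polynomial, and the linear factors of a split
    polynomial determine its roots with multiplicity. Nonnegativity of [d] then gives back [d i] as
    the root of its square. *)
Lemma singular_values_perm m n (A : 'M[C]_(m, n)) (U : 'M[C]_m) (d :
  'I_m -> R) :
    U \is unitarymx -> (forall i, 0 <= d i) ->
    A *m A^t* = U^t* *m real_diag (fun i => d i ^+ 2) *m U ->
  perm_eq (singular_values A) [seq d i | i : 'I_m].
Proof.
move=> Uu d0 E; rewrite perm_sort /eigenvalues.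
case: closed_field_poly_normal => s /= Es.
move: Es; rewrite (monicP (char_poly_monic _)) scale1r => Es.
have /prod_XsubC_eq Hp : \prod_(z <- s) ('X - z%:P) =
    \prod_(z <- [seq (d i ^+ 2)%:C | i : 'I_m]) ('X - z%:P).
  rewrite -Es E -invmx_unitary // char_poly_conj ?unitarymx_unit //.
  rewrite char_poly_trig ?is_diag_mx_is_trig ?diag_mx_is_diag //.
  rewrite big_image /=; apply: eq_bigr => i _.
  by rewrite !mxE eqxx mulr1n.
apply: (perm_trans (perm_map _ Hp)); rewrite -map_comp.
by under eq_map => i do rewrite /= sqrtr_sqr ger0_norm //.
Qed.

Lemma size_singular_values m n (A : 'M[C]_(m, n)) :
  size (singular_values A) = m.
Proof.
rewrite size_sort size_map /eigenvalues; case: closed_field_poly_normal => s /=.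
rewrite (monicP (char_poly_monic _)) scale1r => /(congr1 (fun p :
  {poly C} => size p)).
by rewrite size_char_poly size_prod_XsubC => -[].
Qed.

Lemma sigma_ge0 m n (A : 'M[C]_(m, n)) i : 0 <= sigma A i.
Proof.
have [lt_i|ge_i] := ltnP i (size (singular_values A));
  last by rewrite /sigma nth_default.
have := mem_nth 0 lt_i; rewrite mem_sort => /mapP [z _ E].
by rewrite /sigma E sqrtr_ge0.
Qed.

Lemma sigma_le m n (A : 'M[C]_(m, n)) i j :
  (i <= j)%N -> sigma A j <= sigma A i.
Proof.
move=> le_ij; have [lt_j|ge_j] := ltnP j (size (singular_values A)); last first.
  (* Past the end of the list [nth] returns 0, which lies below every singular value. *)
  by rewrite /sigma [X in X <= _]nth_default // sigma_ge0.
apply: (sorted_leq_nth (leT := >=%R)) => //.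
- by move=> x y z xy yz; exact: le_trans yz xy.
- exact: lexx.
- by apply: sort_sorted => x y /=; exact: le_total.
- exact: leq_ltn_trans lt_j.
Qed.

Lemma sum_sigma m n (A : 'M[C]_(m, n)) :
  \sum_(i < m) sigma A i = \sum_(s <- singular_values A) s.
Proof. by rewrite (big_nth 0) size_singular_values big_mkord. Qed.

(** The list is decreasing, so its nonzero members form an initial segment and the terms from index
    [k] on vanish. *)
Lemma ky_fan_norm_full k m n (A : 'M[C]_(m, n)) :
    (k <= m)%N -> (count (fun s => s != 0%R) (singular_values A) <= k)%N ->
  ky_fan_norm k A = \sum_(s <- singular_values A) s.
Proof.
move=> le_km cnt; rewrite -sum_sigma /ky_fan_norm.
rewrite -!(big_mkord xpredT (sigma A)) [RHS](big_cat_nat (leq0n k) le_km) //=.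
rewrite [X in _ = _ + X]big_nat_cond [X in _ = _ + X]big1 ?addr0 // => i;
  rewrite andbT => /andP [le_ki lt_im].
(* A nonzero value at an index [i >= k] would make the first [i.+1 > k] values nonzero. *)
apply/eqP; apply: contraTT cnt => si0; rewrite -ltnNge.
rewrite -(cat_take_drop i.+1 (singular_values A)) count_cat.
apply: leq_trans (leq_addr _ _); rewrite (@leq_trans i.+1) //.
have /eqP -> : count (fun s => s != 0) (take i.+1 (singular_values A))
  == size (take i.+1 (singular_values A)).
  rewrite -all_count; apply/(all_nthP 0) => j.
  rewrite size_takel ?size_singular_values // => lt_j.
  rewrite nth_take // gt_eqF // (lt_le_trans _ (@sigma_le _ _ A j i _)) //.
  by rewrite lt_def si0 sigma_ge0.
by rewrite size_takel ?size_singular_values.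
Qed.

(** * Spectral form of Hermitian and Gram matrices *)

Lemma adj_row_norm m n (X : 'M[C]_(m, n)) i :
  (X *m X^t*) i i = (\sum_j normc (X i j) ^+ 2)%:C.
Proof.
rewrite mxE rmorph_sum; apply: eq_bigr => j _; rewrite !mxE.
by rewrite rmorphXn -[RHS]/(`|X i j| ^+ 2) sqr_normc.
Qed.

Lemma hermitian_spectral m (H : 'M[C]_m) : H^t* = H ->
  exists (U : 'M[C]_m) (d : 'I_m -> R),
    U \is unitarymx /\ H = U^t* *m real_diag d *m U.
Proof.
move=> Hh; have Hs : H \is hermsymmx.
  by rewrite qualifE expr0 scale1r Hh.
exists (spectralmx H), (fun i => complex.Re (spectral_diag H 0 i)).
split; first exact: spectral_unitarymx.
have /orthomx_spectralP {1}-> := hermitian_normalmx Hs.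
rewrite (invmx_unitary (spectral_unitarymx H)).
suff -> : real_diag (fun i => complex.Re (spectral_diag H 0 i)) =
  diag_mx (spectral_diag H) by [].
congr diag_mx; apply/rowP => i; rewrite mxE RRe_real //.
by have /mxOverP := hermitian_spectral_diag_real Hs.
Qed.

Lemma conj_diagE m n (X : 'M[C]_(m, n)) (d : 'I_m -> R) a b :
  (X^t* *m real_diag d *m X) a b = \sum_i (X i a)^* * (d i)%:C * X i b.
Proof.
rewrite -mulmxA mul_diag_mx mxE; apply: eq_bigr => i _.
by rewrite !mxE mulrA.
Qed.

Lemma gram_spectral m n (A : 'M[C]_(m, n)) :
  exists2 U : 'M[C]_m, U \is unitarymx &
    A *m A^t* = U^t* *m real_diag (fun i => sigma A i ^+ 2) *m U.
Proof.
have [|U [d [Uu E]]] := @hermitian_spectral m (A *m A^t*).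
  exact: gram_adj.
have d0 i : 0 <= d i.
  (* [d i] is the squared length of row [i] of [U *m A]. *)
  have := adj_row_norm (U *m A) i; rewrite gram_mull E (adj_conjK _ Uu).
  rewrite mxE eqxx mulr1n mxE => /complexI ->.
  by apply: sumr_ge0 => j _; exact: sqr_ge0.
have E2 : A *m A^t* = U^t* *m real_diag (fun i => Num.sqrt (d i) ^+ 2) *m U.
  by rewrite E (eq_real_diag (fun i => sqr_sqrtr (d0 i))).
have Hp := singular_values_perm Uu (fun i => sqrtr_ge0 (d i)) E2.
have sz : size (singular_values A) == m by rewrite size_singular_values.
have /(tuple_permP (t := [tuple Num.sqrt (d i) | i < m])) [s Es] := Hp.
have sE (i : 'I_m) : sigma A i = Num.sqrt (d (s i)).
  by rewrite /sigma Es -(tnth_nth 0 [tuple _ | i < m]) !tnth_mktuple.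
(* The diagonal entries match the singular values only up to the permutation [s]; permuting the rows
   of [U] puts them in decreasing order. *)
exists (row_perm s U).
  apply/unitarymxP/matrixP => i j;
    have /unitarymxP/matrixP/(_ (s i) (s j)) := Uu.
  rewrite !mxE (inj_eq perm_inj) => <-.
  by apply: eq_bigr => l _; rewrite !mxE.
rewrite E2; apply/matrixP => a b; rewrite !conj_diagE (reindex_perm s).
by apply: eq_bigr => i _; rewrite sE !mxE.
Qed.

(** Unitary conjugation preserves rank, and the rank of a diagonal matrix counts its nonzero
    entries. *)
Lemma count_singular_values m n (A : 'M[C]_(m, n)) :
  count (fun s => s != 0) (singular_values A) = \rank (A *m A^t*).
Proof.
have [U Uu ->] := gram_spectral A; rewrite rank_adj_conj // rank_diag_mx.
rewrite -sum1_count (big_nth 0) size_singular_values big_mkord big_mkcond /=.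
apply: eq_bigr => i _; rewrite mxE.
by rewrite (inj_eq (@complexI R) _ 0) expf_eq0 /= -/(sigma A i); case: (_ == _).
Qed.

(** * The real inner product on complex matrices, and Cauchy-Schwarz *)

Definition frob m n (X Y : 'M[C]_(m, n)) : R := complex.Re (\tr (X *m Y^t*)).

Lemma ReD (x y : C) : complex.Re (x + y) = complex.Re x + complex.Re y.
Proof. by case: x; case: y. Qed.

Lemma ReZ (a : R) (x : C) : complex.Re (a%:C * x) = a * complex.Re x.
Proof. by case: x => x y /=; rewrite mul0r subr0. Qed.

Lemma Re_sum (I : finType) (F : I -> C) :
  complex.Re (\sum_i F i) = \sum_i complex.Re (F i).
Proof. exact: (big_morph _ ReD). Qed.

Lemma frobE m n (X Y : 'M[C]_(m, n)) :
  frob X Y = \sum_i \sum_j (complex.Re (X i j) * complex.Re (Y i j)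
                           + complex.Im (X i j) * complex.Im (Y i j)).
Proof.
rewrite /frob Re_sum; apply: eq_bigr => i _; rewrite mxE Re_sum.
apply: eq_bigr => j _; rewrite !mxE /=; case: (X i j) (Y i j) => a b [c d] /=.
by rewrite mulrN opprK.
Qed.

Lemma frobC m n (X Y : 'M[C]_(m, n)) : frob X Y = frob Y X.
Proof.
rewrite !frobE; apply: eq_bigr => i _; apply: eq_bigr => j _.
by rewrite mulrC [X in _ + X]mulrC.
Qed.

Lemma frobDl m n (X Y Z : 'M[C]_(m, n)) : frob (X + Y) Z = frob X Z + frob Y Z.
Proof. by rewrite /frob mulmxDl mxtraceD ReD. Qed.

Lemma frobZl m n (a : R) (X Z : 'M[C]_(m, n)) : frob (a%:C *:
  X) Z = a * frob X Z.
Proof. by rewrite /frob -scalemxAl mxtraceZ ReZ. Qed.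

Lemma frob_ge0 m n (X : 'M[C]_(m, n)) : 0 <= frob X X.
Proof.
rewrite frobE; do 2![apply: sumr_ge0 => ? _].
by rewrite -!expr2 addr_ge0 ?sqr_ge0.
Qed.

Lemma frob_eq0 m n (X : 'M[C]_(m, n)) : frob X X = 0 -> X = 0.
Proof.
move=> X0; apply/matrixP => i j; rewrite mxE.
have sq0 a b : 0 <= complex.Re (X a b) * complex.Re (X a b) + complex.Im (X a
  b) * complex.Im (X a b).
  by rewrite -!expr2 addr_ge0 ?sqr_ge0.
move: X0; rewrite frobE => /eqP; rewrite psumr_eq0; last first.
  by move=> a _; apply: sumr_ge0.
move=> /allP/(_ i (mem_index_enum _)); rewrite psumr_eq0 //.
move=> /allP/(_ j (mem_index_enum _)); rewrite -!expr2 paddr_eq0 ?sqr_ge0 //.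
by rewrite !sqrf_eq0; case: (X i j) => a b /= /andP[/eqP -> /eqP ->].
Qed.

(** The expansion behind both Cauchy-Schwarz and its equality case. *)
Lemma frob_defect m n (a b : R) (X Y : 'M[C]_(m, n)) :
  frob (b%:C *: X - a%:C *: Y) (b%:C *: X - a%:C *: Y)
    = b ^+ 2 * frob X X + a ^+ 2 * frob Y Y - 2 * (a * b) * frob X Y.
Proof.
rewrite -scaleNr -rmorphN.
rewrite frobDl !frobZl ![frob _ (_ + _)]frobC !frobDl !frobZl [frob Y X]frobC.
by ring.
Qed.

(** Cauchy-Schwarz with prescribed bounds: expand $0\le|bX-aY|^2$ and cancel $ab$. A zero bound is
    treated apart, since it makes the matrix itself vanish. *)
Lemma frob_le m n (a b : R) (X Y : 'M[C]_(m, n)) : 0 <= a -> 0 <= b ->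
  frob X X <= a ^+ 2 -> frob Y Y <= b ^+ 2 -> frob X Y <= a * b.
Proof.
rewrite le_eqVlt => /orP [/eqP <-|a0].
  rewrite expr0n /= => _ X0 _; have /frob_eq0 -> : frob X X = 0.
    by apply/eqP; rewrite eq_le X0 frob_ge0.
  by rewrite /frob mul0mx mxtrace0 /= mul0r.
rewrite le_eqVlt => /orP [/eqP <-|b0].
  rewrite expr0n /= => _ Y0; have /frob_eq0 -> : frob Y Y = 0.
    by apply/eqP; rewrite eq_le Y0 frob_ge0.
  by rewrite frobC /frob mul0mx mxtrace0 /= mulr0.
move=> Xa Yb; have := frob_ge0 (b%:C *: X - a%:C *: Y); rewrite frob_defect.
have := ler_wpM2l (sqr_ge0 b) Xa; have := ler_wpM2l (sqr_ge0 a) Yb.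
have ab0 : 0 < a * b by exact: mulr_gt0.
rewrite -(ler_pM2l ab0 (frob X Y));
  move: (frob X X) (frob Y Y) (frob X Y) => x y z; lra.
Qed.

(** Under these hypotheses the expansion gives $|bX-aY|^2\le0$. *)
Lemma frob_eq m n (a b : R) (X Y : 'M[C]_(m, n)) :
  frob X X <= a ^+ 2 -> frob Y Y <= b ^+ 2 -> frob X Y = a * b ->
  b%:C *: X = a%:C *: Y.
Proof.
move=> Xa Yb XY; apply/eqP; rewrite -subr_eq0; apply/eqP/frob_eq0.
apply/eqP; rewrite eq_le frob_ge0 andbT frob_defect XY.
have := ler_wpM2l (sqr_ge0 b) Xa; have := ler_wpM2l (sqr_ge0 a) Yb.
move: (frob X X) (frob Y Y) => x y; lra.
Qed.

(** * Projections, partial isometries and the dual form of the Ky Fan norm *)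

Lemma frobM_adj m n p (X : 'M[C]_(p, m)) (W : 'M[C]_(m, n)) :
  frob (X *m W) (X *m W) = frob (X *m (W *m W^t*)) X.
Proof. by rewrite /frob adjointM !mulmxA. Qed.

Lemma frobBB m n (X Y : 'M[C]_(m, n)) :
  frob (X - Y) (X - Y) = frob X X + frob Y Y - 2 * frob X Y.
Proof. by have := frob_defect 1 1 X Y;
  rewrite rmorph1 !scale1r expr1n !(mul1r, mulr1). Qed.

(** Pythagoras for the orthogonal projection [Q], with $|XW|^2=\langle XQ,X\rangle=|XQ|^2$. *)
Lemma projection_defect m n p (X : 'M[C]_(p, m)) (W : 'M[C]_(m, n)) :
  let Q := W *m W^t* in Q *m Q = Q ->
  frob (X - X *m Q) (X - X *m Q) = frob X X - frob (X *m W) (X *m W).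
Proof.
move=> Q QQ; have Qh : Q^t* = Q by rewrite adjointM trmxCK.
by rewrite frobBB (frobM_adj X Q) Qh QQ [frob X (_ *m _)]frobC (frobM_adj X W)
  -/Q; ring.
Qed.

(** In an eigenbasis of the Gram matrix the identity is $\sigma^4=s^2\sigma^2$ for each singular
    value. *)
Lemma gram_idemP m n (D : 'M[C]_(m, n)) (s : R) :
  (D *m D^t*) *m (D *m D^t*) = (s ^+ 2)%:C *: (D *m D^t*) <->
  {in singular_values D, forall t, t = 0 \/ t ^+ 2 = s ^+ 2}.
Proof.
have [U Uu E] := gram_spectral D.
have E2 : (D *m D^t*) *m (D *m D^t*) =
    U^t* *m real_diag (fun i => sigma D i ^+ 2 * sigma D i ^+ 2) *m U.
  by rewrite E -real_diagM; exact: adj_conjM.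
have E3 : (s ^+ 2)%:C *: (D *m D^t*) =
    U^t* *m real_diag (fun i => s ^+ 2 * sigma D i ^+ 2) *m U.
  by rewrite E -scale_real_diag -scalemxAr -scalemxAl.
split=> [H t /(nthP (0 : R)) | H].
  case=> i; rewrite size_singular_values => lt_i <-.
  have /matrixP/(_ (Ordinal lt_i) (Ordinal lt_i)) :
      real_diag (fun i : 'I_m => sigma D i ^+ 2 * sigma D i ^+ 2)
      = real_diag (fun i : 'I_m => s ^+ 2 * sigma D i ^+ 2).
    by rewrite -(adj_conjK (real_diag _) Uu) -E2 H E3 (adj_conjK _ Uu).
  rewrite !mxE eqxx !mulr1n => /complexI /eqP;
    rewrite -subr_eq0 -mulrBl mulf_eq0.
  rewrite subr_eq0 expf_eq0 /= -/(sigma D i) => /orP [/eqP ->|/eqP ->];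
    [right|left] => //.
rewrite E2 E3; congr (_ *m _); congr (_ *m _); apply: eq_real_diag => i.
have /H : sigma D i \in singular_values D by rewrite mem_nth //
  size_singular_values.
by case=> ->; rewrite ?expr0n ?mul0r ?mulr0.
Qed.

Lemma frob_singular_values m n (D : 'M[C]_(m, n)) :
  frob D D = \sum_(s <- singular_values D) s ^+ 2.
Proof.
have [U Uu E] := gram_spectral D.
rewrite /frob E (tr_adj_conj _ Uu) tr_real_diag /=.
by rewrite (big_nth 0) size_singular_values big_mkord.
Qed.

(* [W] is the partial isometry of the polar decomposition of [A], cut down to
   the singular vectors of the [k] largest singular values; [0^-1 = 0] kills the
   vanishing ones. *)
Lemma ky_fan_dual k m n (A : 'M[C]_(m, n)) : (k <= m)%N ->
  exists W : 'M[C]_(m, n),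
    [/\ (W *m W^t*) *m (W *m W^t*) = W *m W^t*,
        frob W W <= k%:R & frob A W = ky_fan_norm k A].
Proof.
move=> le_km; have [U Uu E] := gram_spectral A.
pose g (i : 'I_m) := if (i < k)%N then (sigma A i)^-1 else 0.
pose e (i : 'I_m) : R := ((i < k)%N && (sigma A i != 0))%:R.
pose W := U^t* *m real_diag g *m U *m A.
pose G := U^t* *m real_diag g *m U.
have WG : W = G *m A by [].
have GG : G^t* = G by apply: adj_conj_adj; exact: real_diag_adj.
have GA : G *m (A *m A^t*) =
    U^t* *m (real_diag g *m real_diag (fun i => sigma A i ^+ 2)) *m U.
  by rewrite E; exact: adj_conjM.
(* Since [G] is Hermitian and diagonal in the eigenbasis of the Gram matrix of [A], the product is
   diagonal there too, with entries $g_i^2\sigma_i^2$, each 0 or 1. *)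
have WW : W *m W^t* = U^t* *m real_diag e *m U.
  transitivity (G *m (A *m A^t*) *m G); first by rewrite -[X in _ = _ *m X]GG;
    exact: gram_mull.
  rewrite GA; apply: etrans (adj_conjM _ _ Uu) _; rewrite !real_diagM.
  congr (_ *m _); congr (_ *m _); apply: eq_real_diag => i; rewrite /g /e.
  case: ifP => _ /=; last by rewrite !mul0r.
  case: eqP => [->|/eqP s0]; first by rewrite invr0 !mul0r.
  by rewrite expr2 mulrA mulVf // mul1r mulfV.
have ee : real_diag e *m real_diag e = real_diag e.
  rewrite real_diagM; apply: eq_real_diag => i.
  by rewrite /e; case: (_ && _); rewrite ?mulr1 ?mulr0.
exists W; split.
- rewrite WW; exact: etrans (adj_conjM _ _ Uu)
    (congr1 (fun X => U^t* *m X *m U) ee).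
- rewrite /frob WW (tr_adj_conj _ Uu) tr_real_diag /=.
  rewrite -[X in _ <= X%:R]card_ord -sumr_const (big_ord_widen m (fun=> 1)) //.
  rewrite [X in _ <= X]big_mkcond; apply: ler_sum => i _; rewrite /e.
  by case: ifP => //= _; rewrite lern1 leq_b1.
rewrite frobC /frob WG -mulmxA GA real_diagM (tr_adj_conj _ Uu).
rewrite tr_real_diag /= /ky_fan_norm (big_ord_widen m _ le_km).
rewrite [RHS]big_mkcond; apply: eq_bigr => i _; rewrite /g.
case: ifP => _; last by rewrite mul0r.
have [->|s0] := eqVneq (sigma A i) 0; first by rewrite expr2 !mulr0.
by rewrite expr2 mulKf.
Qed.

(** * All-ones matrices and plainness *)

Lemma adj_all_ones m n : (all_ones m n : 'M[C]_(m, n))^t* = all_ones n m.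
Proof. by apply/matrixP => i j; rewrite !mxE rmorph1. Qed.

Lemma mul_all_ones m n p :
  (all_ones m n : 'M[C]_(m, n)) *m all_ones n p = (n%:R : R)%:C *: all_ones m p.
Proof.
apply/matrixP => i j; rewrite !mxE; under eq_bigr => l _ do rewrite !mxE mulr1.
by rewrite sumr_const card_ord mulr1 rmorph_nat.
Qed.

Lemma all_ones_outer m n : (all_ones m n :
  'M[C]_(m, n)) = all_ones m 1 *m all_ones 1 n.
Proof. by rewrite mul_all_ones rmorph1 scale1r. Qed.

Lemma frob_row_ones n : frob (all_ones 1 n :
  'M[C]_(1, n)) (all_ones 1 n) = n%:R.
Proof.
rewrite /frob adj_all_ones mul_all_ones mxtraceZ ReZ /mxtrace big_ord1 mxE /=.
by rewrite mulr1.
Qed.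

Lemma frob_ones_row m n (W : 'M[C]_(m, n)) :
  frob (all_ones m n) W = frob (all_ones 1 n) (all_ones 1 m *m W).
Proof.
by rewrite /frob all_ones_outer adjointM adj_all_ones -mulmxA mxtrace_mulC
  mulmxA.
Qed.

Lemma row_ones_projection_le m n (W : 'M[C]_(m, n)) :
  let Q := W *m W^t* in Q *m Q = Q ->
  frob (all_ones 1 m *m W) (all_ones 1 m *m W) <= m%:R.
Proof.
move=> Q QQ; rewrite -frob_row_ones -subr_ge0 -projection_defect //.
exact: frob_ge0.
Qed.

Lemma sqrt_natM m n : Num.sqrt (m * n)%:R = Num.sqrt n%:R * Num.sqrt m%:R :> R.
Proof. by rewrite mulnC natrM sqrtrM ?ler0n. Qed.

(** The all-ones matrix is an outer product, so this pairs $j_n^*$, of length $\sqrt n$, with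
    $j_m^*W$, of length at most $\sqrt m$. *)
Lemma frob_ones_le m n (W : 'M[C]_(m, n)) :
  let Q := W *m W^t* in Q *m Q = Q ->
  frob (all_ones m n) W <= Num.sqrt (m * n)%:R.
Proof.
move=> Q QQ; rewrite frob_ones_row sqrt_natM; apply: frob_le;
  rewrite ?sqrtr_ge0 //.
  by rewrite frob_row_ones sqr_sqrtr ?ler0n.
by rewrite sqr_sqrtr ?ler0n // row_ones_projection_le.
Qed.

(** For real entries the complex inner product in [plain] is the real pairing with the all-ones
    matrix; clearing the positive $\sqrt{mn}$ leaves an equation in [R]. *)
Lemma plainE m n (D : 'M[C]_(m, n)) : (0 < m)%N -> (0 < n)%N ->
    (forall i j, complex.Im (D i j) = 0) ->
  plain D <-> sigma D 0 * Num.sqrt (m * n)%:R = frob (all_ones m n) D.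
Proof.
move=> m0 n0 Dr; rewrite /plain.
have -> : (all_ones 1 m *m D *m all_ones n 1) 0 0 = (frob (all_ones m n) D)%:C.
  transitivity (\sum_i \sum_j D i j).
    rewrite mxE [RHS]exchange_big; apply: eq_bigr => j _; rewrite !mxE mulr1.
    by apply: eq_bigr => i _; rewrite !mxE mul1r.
  rewrite frobE rmorph_sum; apply: eq_bigr => i _.
  rewrite rmorph_sum; apply: eq_bigr => j _.
  by rewrite !mxE /= mul1r mul0r addr0; move: (Dr i j);
    case: (D i j) => a b /= ->.
have N0 : Num.sqrt (m * n)%:R != 0 :> R by rewrite gt_eqF // sqrtr_gt0 ltr0n
  muln_gt0 m0.
rewrite -fmorph_div; split=> [/complexI ->|<-]; first by rewrite mulfVK.
by rewrite mulfK.
Qed.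

(** The eigenvalues of the positive semidefinite root [S] are nonnegative with squares the
    eigenvalues of the Gram matrix, so they are the singular values of [A]. *)
Lemma psd_root_singular_values m n (A : 'M[C]_(m, n)) (S : 'M[C]_m) :
    S^t* = S -> (forall x :
      'rV_m, 0 <= frob (x *m S) x) -> A *m A^t* = S *m S ->
  \sum_(s <- singular_values A) s = complex.Re (\tr S).
Proof.
move=> Sh S0 AS; have [U [d [Uu E]]] := hermitian_spectral Sh.
have d0 i : 0 <= d i.
  (* The quadratic form of [S] at row [i] of [U] takes the value [d i]. *)
  have := S0 (row i U); rewrite /frob -row_mul /mxtrace big_ord1.
  have := congr1 (fun X : 'M[C]_m => X i i) (adj_conjK (real_diag d) Uu).
  rewrite -E /= [in RHS]mxE eqxx mulr1n !mxE => Ei.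
  suff -> : \sum_j row i (U *m S) 0 j * (row i U)^t* j 0 = (d i)%:C by [].
  by rewrite -Ei; apply: eq_bigr => j _; rewrite !mxE.
have E2 : A *m A^t* = U^t* *m real_diag (fun i => d i ^+ 2) *m U.
  by rewrite AS E; apply: etrans (adj_conjM _ _ Uu) _; rewrite real_diagM.
have Hp := singular_values_perm Uu d0 E2.
rewrite (perm_big _ Hp) big_image /= E (tr_adj_conj _ Uu).
by rewrite tr_real_diag.
Qed.

(** * The entrywise maximum and scaled Gram matrices *)

Lemma max_norm_ge m n (A : 'M[C]_(m, n)) i j : normc (A i j) <= max_norm A.
Proof. exact: (le_bigmax 0 (fun ij :
  'I_m * 'I_n => normc (A ij.1 ij.2)) (i, j)). Qed.

Lemma max_norm_ge0 m n (A : 'M[C]_(m, n)) : 0 <= max_norm A.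
Proof. exact: bigmax_ge_id. Qed.

Lemma normc_nneg (z : C) : 0 <= z -> normc z = complex.Re z.
Proof.
case: z => a b; rewrite lecE /= => /andP [/eqP -> a0].
by rewrite expr0n addr0 sqrtr_sqr ger0_norm.
Qed.

Lemma max_norm_gt0 m n (A : 'M[C]_(m, n)) : A != 0 -> 0 < max_norm A.
Proof.
move=> A0; rewrite lt_def max_norm_ge0 andbT; apply: contraNneq A0 => M0.
apply/eqP/matrixP => i j; rewrite mxE; apply: eq0_normc; apply/eqP.
rewrite eq_le -{1}M0 max_norm_ge /=; case: (A i j) => a b /=; exact: sqrtr_ge0.
Qed.

Lemma gramZ m n (a : R) (W : 'M[C]_(m, n)) :
  (a%:C *: W) *m (a%:C *: W)^t* = (a ^+ 2)%:C *: (W *m W^t*).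
Proof. by rewrite adjointZ -scalemxAl -scalemxAr scalerA -rmorphM expr2. Qed.

(** Cancelling $s^4$ turns the spectral condition of [gram_idemP] on [D] into idempotence for
    [W]. *)
Lemma gramZ_idem m n (s : R) (D W : 'M[C]_(m, n)) : s != 0 -> D = s%:C *: W ->
  (D *m D^t*) *m (D *m D^t*) = (s ^+ 2)%:C *: (D *m D^t*) <->
  (W *m W^t*) *m (W *m W^t*) = W *m W^t*.
Proof.
move=> s0 ->; have c0 : (s ^+ 2)%:C * (s ^+ 2)%:C != 0.
  by rewrite -rmorphM (inj_eq (@complexI R) _ 0) !mulf_neq0 ?expf_neq0.
rewrite gramZ -scalemxAl -scalemxAr !scalerA.
by split=> [/(scalerI c0)|->].
Qed.

Lemma sum_two_valued (s : seq R) (a : R) :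
  (forall t, t \in s -> t = 0 \/ t = a) ->
  a != 0 -> \sum_(t <- s) t ^+ 2 = (count (fun t => t != 0) s)%:R * a ^+ 2.
Proof.
move=> H a0; elim: s H => [|t s IHs] H; first by rewrite big_nil mul0r.
rewrite big_cons IHs => [|u us]; last by apply: H; rewrite inE us orbT.
have [->|->] := H t (mem_head _ _); first by rewrite /= eqxx expr0n add0r.
by rewrite /= a0 natrD mulrDl mul1r.
Qed.

(** * The shifted matrix [D] and the upper bound *)

Section Nonneg.
Variables (m n : nat) (A : 'M[C]_(m, n)).
Hypothesis A_ge0 : forall i j, 0 <= A i j.
Let M := max_norm A.
Let N : R := Num.sqrt (m * n)%:R.
Let J : 'M[C]_(m, n) := all_ones m n.
Let D : 'M[C]_(m, n) := 2 *: A - M%:C *: J.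
Let x i j := complex.Re (A i j).

Let A_re i j : A i j = (x i j)%:C.
Proof. by have := A_ge0 i j; rewrite /x;
  case: (A i j) => a b /ger0_Im /= ->. Qed.

Let x_ge0 i j : 0 <= x i j.
Proof. by have := A_ge0 i j; rewrite A_re ler0c. Qed.

Let x_leM i j : x i j <= M.
Proof. by rewrite /x -normc_nneg // max_norm_ge. Qed.

Lemma shiftE i j : D i j = (2 * x i j - M)%:C.
Proof. by rewrite !mxE A_re mulr1 rmorphB rmorphM rmorph_nat. Qed.

(** Entrywise $M^2-(2x-M)^2=4x(M-x)$, which is nonnegative on $[0,M]$ and zero only at the ends;
    this yields the bound on $|D|$ and its equality case. *)
Lemma shift_defect :
  (M * N) ^+ 2 - frob D D = \sum_i \sum_j 4 * (x i j * (M - x i j)).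
Proof.
have -> : (M * N) ^+ 2 = \sum_(i < m) \sum_(j < n) M ^+ 2.
  rewrite !sumr_const !card_ord -mulrnA exprMn sqr_sqrtr ?ler0n //.
  by rewrite mulnC mulr_natr.
rewrite frobE -sumrB; apply: eq_bigr => i _; rewrite -sumrB;
  apply: eq_bigr => j _.
by rewrite shiftE /= mulr0 addr0; ring.
Qed.

Lemma frob_shift_le : frob D D <= (M * N) ^+ 2.
Proof.
rewrite -subr_ge0 shift_defect; do 2![apply: sumr_ge0 => ? _].
by rewrite mulr_ge0 // mulr_ge0 // subr_ge0.
Qed.

Lemma frob_shift_eq :
  frob D D = (M * N) ^+ 2 <-> forall i j, A i j = 0 \/ A i j = M%:C.
Proof.
have pos i j : 0 <= 4 * (x i j * (M - x i j)).
  by rewrite mulr_ge0 // mulr_ge0 // subr_ge0.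
split=> [E i j | H].
  have /eqP := shift_defect; rewrite E subrr eq_sym psumr_eq0; last first.
    by move=> a _; apply: sumr_ge0.
  move=> /allP/(_ i (mem_index_enum _)); rewrite psumr_eq0 //.
  move=> /allP/(_ j (mem_index_enum _));
    rewrite A_re !mulf_eq0 pnatr_eq0 /= subr_eq0.
  by case/orP => /eqP ->; [left|right].
apply/eqP; rewrite eq_sym -subr_eq0 shift_defect big1 // => i _;
  rewrite big1 // => j _.
have := H i j; rewrite A_re => -[/complexI ->|/complexI ->].
  by rewrite mul0r mulr0.
by rewrite subrr !mulr0.
Qed.

Lemma zero_one_multipleP : A != 0 ->
  (exists (c : C) (B : 'M[C]_(m, n)), zero_one_mx B /\ A = c *: B) <->
  forall i j, A i j = 0 \/ A i j = M%:C.
Proof.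
move=> A0; have M0 := max_norm_gt0 A0; rewrite -/M in M0.
have Mc0 : M%:C != 0 by rewrite (inj_eq (@complexI R) _ 0) gt_eqF.
split=> [[c [B [B01 E]]] i j | H].
  (* As [A] is nonzero, some entry of [B] is 1, so [c] is itself an entry of [A], hence nonnegative
     and equal to the maximum. *)
  have [a [b Bab]] : exists a b, B a b = 1.
    have [/existsP [a /existsP [b /eqP Bab]] | /existsPn H] :=
        boolP [exists a, [exists b, B a b == 1]]; first by exists a, b.
    case/eqP: A0; rewrite E; apply/matrixP => a b; rewrite !mxE.
    have [->|B1] := B01 a b; first by rewrite mulr0.
    by have /existsPn/(_ b) := H a; rewrite B1 eqxx.
  have Aab : A a b = c by rewrite E mxE Bab mulr1.
  have c0 : 0 <= c by rewrite -Aab.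
  have nc0 : 0 <= normc c by rewrite normc_nneg // -ler0c RRe_real // ger0_real.
  have cM : normc c = M.
    apply/eqP; rewrite eq_le -{1}Aab max_norm_ge; apply/bigmax_leP;
      split=> // -[u v] _ /=.
    by rewrite E mxE; have [->|->] := B01 u v; rewrite ?mulr1 // mulr0 normc0.
  rewrite E mxE; have [->|->] := B01 i j; [left|right]; rewrite ?mulr0 // mulr1.
  by rewrite -cM normc_nneg // RRe_real // ger0_real.
exists M%:C, (M%:C^-1 *: A); split; last by rewrite scalerA mulfV // scale1r.
move=> i j; rewrite mxE; have [->|->] := H i j; [left|right];
  first by rewrite mulr0.
by rewrite mulVf.
Qed.

Lemma frob_double (W : 'M[C]_(m, n)) :
  2 * frob A W = frob D W + M * frob J W.
Proof.
have E : (2 : R)%:C *: A = D + M%:C *: J by rewrite subrK rmorph_nat.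
by rewrite -frobZl E frobDl frobZl.
Qed.

Lemma ky_fan_le k : (k <= m)%N ->
  ky_fan_norm k A <= 1 / 2 * (1 + Num.sqrt k%:R) * N * M.
Proof.
move=> le_km; have [W [QQ Wk <-]] := ky_fan_dual A le_km.
have DW : frob D W <= M * N * Num.sqrt k%:R.
  apply: frob_le; rewrite ?mulr_ge0 ?max_norm_ge0 ?sqrtr_ge0 ?frob_shift_le //.
  by rewrite sqr_sqrtr ?ler0n.
have JW := ler_wpM2l (max_norm_ge0 A) (frob_ones_le QQ).
have := frob_double W; move: DW JW; rewrite -/J -/N -/M.
move: (frob D W) (frob J W) (frob A W) => d j a; lra.
Qed.

(** * From equality to the structure of [D] *)

Hypothesis A_neq0 : A != 0.
Let M_gt0 : 0 < M := max_norm_gt0 A_neq0.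

Let mn_gt0 : (0 < m * n)%N.
Proof.
rewrite muln_gt0 !lt0n; apply/andP; split; apply: contraNneq A_neq0 => E.
  by apply/eqP/matrixP => -[i lti]; exfalso; move: lti; rewrite E.
by apply/eqP/matrixP => i [j ltj]; exfalso; move: ltj; rewrite E.
Qed.

Let N_gt0 : 0 < N.
Proof. by rewrite sqrtr_gt0 ltr0n. Qed.

Let m_gt0 : (0 < m)%N. Proof. by move: mn_gt0;
  rewrite muln_gt0 => /andP []. Qed.
Let n_gt0 : (0 < n)%N. Proof. by move: mn_gt0;
  rewrite muln_gt0 => /andP []. Qed.

Lemma shift_real i j : complex.Im (D i j) = 0.
Proof. by rewrite shiftE. Qed.

Lemma ky_fan_eq_shift k : (0 < k)%N -> (k <= m)%N ->
    ky_fan_norm k A = 1 / 2 * (1 + Num.sqrt k%:R) * N * M ->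
  (forall i j, A i j = 0 \/ A i j = M%:C) /\
  plain D /\ has_exactly_k_nonzero_singular_values k D /\
    nonzero_singular_values_equal D.
Proof.
move=> k0 le_km; have [W [QQ Wk <-]] := ky_fan_dual A le_km => kyE.
have b0 : 0 < Num.sqrt k%:R :> R by rewrite sqrtr_gt0 ltr0n.
have Wb : frob W W <= Num.sqrt k%:R ^+ 2 by rewrite sqr_sqrtr ?ler0n.
have a0 : 0 < M * N by rewrite mulr_gt0.
have DWle : frob D W <= M * N * Num.sqrt k%:R.
  by apply: frob_le; rewrite ?frob_shift_le // ltW.
have JWle : frob J W <= N := frob_ones_le QQ.
have dbl := frob_double W; rewrite kyE in dbl.
(* The two upper bounds add up to the value in [dbl], so neither can be strict. *)
have JW : frob J W = N.
  apply/eqP; rewrite eq_le JWle -(ler_pM2l M_gt0).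
  move: DWle dbl; move: (frob D W) (frob J W) => d j; lra.
have DW : frob D W = M * N * Num.sqrt k%:R.
  move: dbl; rewrite JW; move: (frob D W) => d; lra.
(* The factor between [D] and [W] in the equality case of Cauchy-Schwarz, from the bounds $MN$ and
   $\sqrt k$ on their lengths. *)
pose s := M * N / Num.sqrt k%:R.
have s0 : 0 < s by rewrite divr_gt0.
have DsW : D = s%:C *: W.
  have := frob_eq frob_shift_le Wb DW.
  move/(congr1 (fun X => (Num.sqrt k%:R : R)^-1%:C *: X));
    rewrite !scalerA -!rmorphM.
  by rewrite mulVf ?gt_eqF // rmorph1 scale1r => ->; rewrite mulrC.
have DD : frob D D = (M * N) ^+ 2.
  by rewrite {2}DsW frobC frobZl frobC DW /s mulrACA mulVf ?gt_eqF // mulr1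
    expr2.
split; first exact/frob_shift_eq.
have sv2 : {in singular_values D, forall t, t = 0 \/ t = s}.
  move=> t tD; have tge0 : 0 <= t.
    have /(nthP (0 : R)) [i _ <-] := tD; exact: sigma_ge0.
  have /gram_idemP/(_ t tD) := (gramZ_idem (lt0r_neq0 s0) DsW).2 QQ.
  case=> [->|/eqP]; first by left.
  by rewrite eqrXn2 ?(ltW s0) // => /eqP ->; right.
(* The squared singular values sum to $|D|^2=(MN)^2=ks^2$, and each nonzero one contributes
   $s^2$. *)
have cnt : count (fun t => t != 0) (singular_values D) = k.
  have := frob_singular_values D; rewrite (sum_two_valued sv2) ?gt_eqF // DD.
  have -> : (M * N) ^+ 2 = k%:R * s ^+ 2.
    by rewrite /s expr_div_n sqr_sqrtr ?ler0n // mulrCA mulfV ?mulr1 //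
      pnatr_eq0 -lt0n.
  move/(mulIf (expf_neq0 2 (lt0r_neq0 s0)))/eqP; rewrite eqr_nat => /eqP <-.
  by [].
split; last first.
  split=> // t u tD uD; have [->|->] := sv2 t tD; first by rewrite eqxx.
  by have [->|->] := sv2 u uD; first by rewrite eqxx.
apply/plainE => //; first exact: shift_real.
have -> : sigma D 0 = s.
  have : sigma D 0 \in singular_values D by rewrite mem_nth //
    size_singular_values.
  (* If the largest singular value vanished, all would, contradicting [k0]. *)
  case/sv2 => // E0; move: k0; rewrite -cnt -has_count => /hasP [t tD /negP []].
  have /(nthP (0 : R)) [i _ <-] := tD.
  by rewrite eq_le sigma_ge0 andbT -[X in _ <= X]E0 sigma_le.
by rewrite frobC {1}DsW frobZl frobC JW.
Qed.

(** * From plainness back to equality *)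

Lemma plain_projection (W : 'M[C]_(m, n)) :
    let Q := W *m W^t* in Q *m Q = Q -> frob J W = N ->
  all_ones 1 m *m Q = all_ones 1 m /\
  W *m J^t* = (N / m%:R)%:C *: all_ones m m.
Proof.
move=> Q QQ JW; have mR : 0 < m%:R :> R by rewrite ltr0n.
have nR : 0 < n%:R :> R by rewrite ltr0n.
have sm : 0 < Num.sqrt m%:R :> R by rewrite sqrtr_gt0.
have sn : 0 < Num.sqrt n%:R :> R by rewrite sqrtr_gt0.
(* Equality in Cauchy-Schwarz makes $j_n^*$ and $j_m^*W$ parallel. *)
have E : (Num.sqrt m%:R)%:C *: (all_ones 1 n : 'M[C]_(1, n))
    = (Num.sqrt n%:R)%:C *: (all_ones 1 m *m W).
  apply: frob_eq; rewrite ?sqr_sqrtr ?ler0n ?frob_row_ones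
    ?row_ones_projection_le //.
  by rewrite -frob_ones_row JW /N sqrt_natM.
have jW : all_ones 1 m *m W = (Num.sqrt m%:R / Num.sqrt n%:R)%:C *:
  all_ones 1 n.
  rewrite mulrC rmorphM -scalerA E scalerA -rmorphM mulVf ?gt_eqF //.
  by rewrite rmorph1 scale1r.
(* $j_m^*W$ has the full length $\sqrt m$, so the projection defect of $j_m^*$ is zero. *)
have jQ : all_ones 1 m *m Q = all_ones 1 m.
  apply/esym/eqP; rewrite -subr_eq0; apply/eqP/frob_eq0.
  rewrite (projection_defect _ QQ) jW frobZl frobC frobZl !frob_row_ones.
  rewrite mulrA -expr2 expr_div_n !sqr_sqrtr ?ler0n // mulfVK ?subrr //.
  by rewrite gt_eqF.
split=> //; have Qh : Q^t* = Q := gram_adj W.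
(* Column version: $j_n$ is a multiple of $W^*j_m$, so $Wj_n$ is the same multiple of $Qj_m=j_m$. *)
have Wj : W *m all_ones n 1 = (Num.sqrt n%:R / Num.sqrt m%:R)%:C *:
  all_ones m 1.
  rewrite -[all_ones n 1]adj_all_ones.
  have -> : (all_ones 1 n : 'M[C]_(1, n))
      = (Num.sqrt n%:R / Num.sqrt m%:R)%:C *: (all_ones 1 m *m W).
    rewrite mulrC rmorphM -scalerA -E scalerA -rmorphM mulVf ?gt_eqF //.
    by rewrite rmorph1 scale1r.
  rewrite adjointZ adjointM -scalemxAr mulmxA -/Q adj_all_ones; congr (_ *: _).
  by rewrite -[LHS]trmxCK adjointM adj_all_ones Qh jQ adj_all_ones.
rewrite adj_all_ones all_ones_outer mulmxA Wj -scalemxAl -all_ones_outer.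
congr (_%:C *: _); rewrite /N sqrt_natM.
rewrite -[X in _ = _ / X](sqr_sqrtr (ltW mR)) expr2 invfM mulrA mulfK ?gt_eqF
  //.
Qed.

Lemma ky_fan_eq_of_plain k : (0 < k)%N -> (k <= m)%N ->
    (forall i j, A i j = 0 \/ A i j = M%:C) ->
    plain D -> has_exactly_k_nonzero_singular_values k D ->
    nonzero_singular_values_equal D ->
  ky_fan_norm k A = 1 / 2 * (1 + Num.sqrt k%:R) * N * M.
Proof.
move=> k0 le_km /frob_shift_eq DD /(plainE m_gt0 n_gt0 shift_real) DJ cnt eqs.
pose s := sigma D 0.
have sD : s \in singular_values D by rewrite mem_nth // size_singular_values.
have s_neq0 : s != 0.
  apply/eqP => E0; move: k0; rewrite -cnt -has_count => /hasP [t tD /negP []].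
  have /(nthP (0 : R)) [i _ <-] := tD.
  by rewrite eq_le sigma_ge0 andbT -[X in _ <= X]E0 sigma_le.
have s_gt0 : 0 < s by rewrite lt_def s_neq0 sigma_ge0.
have sv2 : {in singular_values D, forall t, t = 0 \/ t = s}.
  move=> t tD; have [->|t0] := eqVneq t 0; [by left | right].
  exact: eqs.
have ks : k%:R * s ^+ 2 = (M * N) ^+ 2.
  by rewrite -DD frob_singular_values (sum_two_valued sv2) // cnt.
have b0 : 0 < Num.sqrt k%:R :> R by rewrite sqrtr_gt0 ltr0n.
have bs : Num.sqrt k%:R * s = M * N.
  apply/eqP; rewrite -(@eqrXn2 _ 2) // ?mulr_ge0 ?ltW // exprMn sqr_sqrtr
    ?ler0n //.
  by rewrite ks.
pose W := (s^-1)%:C *: D.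
have DsW : D = s%:C *: W.
  by rewrite scalerA -rmorphM mulfV // rmorph1 scale1r.
pose Q := W *m W^t*.
have QQ : Q *m Q = Q.
  apply/(gramZ_idem s_neq0 DsW)/gram_idemP => t tD.
  by have [->|->] := sv2 t tD; [left | right].
have JW : frob J W = N.
  by rewrite frobC frobZl frobC -DJ -/s mulKf.
have trQ : complex.Re (\tr Q) = k%:R.
  rewrite -/(frob W W) frobZl frobC frobZl DD -ks mulrA -expr2 mulrCA -exprMn.
  by rewrite mulVf // expr1n mulr1.
clearbody W.
have [jQ WJ] := plain_projection QQ JW.
have Qh : Q^t* = Q := gram_adj W.
pose J1 : 'M[C]_m := all_ones m m.
have J1h : J1^t* = J1 by rewrite adj_all_ones.
have J1Q : J1 *m Q = J1 by rewrite /J1 all_ones_outer -mulmxA jQ.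
have QJ1 : Q *m J1 = J1 by rewrite -[LHS]trmxCK adjointM Qh J1h J1Q.
(* [a] comes from $A=aW+(M/2)J$. In $S^2$ the choice of [b] makes $2ab=aMN/m$ match the cross terms
   of the Gram matrix of [A], and $b^2m=M^2n/4$ match the term from $J$, because $N^2=mn$. *)
pose a := s / 2; pose b := M * N / 2 / m%:R.
pose S := a%:C *: Q + b%:C *: J1.
have mR : m%:R != 0 :> R by rewrite pnatr_eq0 -lt0n.
have Sh : S^t* = S.
  by rewrite /S linearD map_mxD !adjointZ Qh J1h.
(* [Q] and [J1] are Gram matrices, and their coefficients are nonnegative. *)
have S_ge0 (v : 'rV_m) : 0 <= frob (v *m S) v.
  rewrite mulmxDr frobDl -!scalemxAr !frobZl addr_ge0 // mulr_ge0 //.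
  - by rewrite divr_ge0 // ltW.
  - by rewrite -frobM_adj frob_ge0.
  - by rewrite !divr_ge0 ?ler0n // mulr_ge0 ?ltW.
  by rewrite /J1 all_ones_outer -[all_ones 1 m]adj_all_ones -frobM_adj frob_ge0.
have J1J1 : J1 *m J1 = m%:R%:C *: J1 by rewrite mul_all_ones.
have AA : A *m A^t* = S *m S.
  have AE : A = a%:C *: W + (M / 2)%:C *: J.
    have : (2 : R)%:C *: A = s%:C *: W + M%:C *:
      J by rewrite -DsW subrK rmorph_nat.
    move/(congr1 (fun X => (2^-1 : R)%:C *: X));
      rewrite scalerDr !scalerA -!rmorphM.
    by rewrite mulVf ?pnatr_eq0 // rmorph1 scale1r ![2^-1 * _]mulrC.
  have JW' : J *m W^t* = (N / m%:R)%:C *: J1.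
    by rewrite -[LHS]trmxCK adjointM trmxCK WJ adjointZ J1h.
  have JJ : J *m J^t* = n%:R%:C *: J1 by rewrite adj_all_ones mul_all_ones.
  rewrite {1 2}AE linearD map_mxD !adjointZ /S !mulmxDl !mulmxDr.
  rewrite -!scalemxAl -!scalemxAr !scalerA JJ WJ JW' J1J1 QQ QJ1 J1Q !scalerA
    -/Q.
  rewrite -!addrA; congr (_ + _); rewrite !addrA -!scalerDl -!rmorphM -!rmorphD.
  congr (_%:C *: _).
  have NN : N * N = m%:R * n%:R by rewrite -expr2 sqr_sqrtr ?ler0n // natrM.
  have -> : n%:R = N * N / m%:R by rewrite NN mulrC mulKf.
  by rewrite /a /b; field.
have trS : complex.Re (\tr S) = a * k%:R + M * N / 2.
  rewrite mxtraceD !mxtraceZ ReD !ReZ trQ; congr (_ + _).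
  rewrite /b /mxtrace; under eq_bigr => i _ do rewrite mxE.
  rewrite sumr_const card_ord -(rmorph_nat (real_complex R)) /=.
  by rewrite mulfVK.
(* The rank bound proved last lets the Ky Fan norm be replaced by the sum of all singular values,
   which is the trace of [S]. *)
rewrite (ky_fan_norm_full le_km).
  rewrite (psd_root_singular_values Sh S_ge0 AA) trS.
  have -> : a * k%:R = Num.sqrt k%:R * (M * N) / 2.
    by rewrite -bs mulrA -expr2 sqr_sqrtr ?ler0n // /a mulrC mulrA.
  by rewrite /N; field.
rewrite count_singular_values AA -cnt count_singular_values.
(* [Q] is a multiple of the Gram matrix of [D] and [Q *m S = S], so [S] factors through that Gram
   matrix, whose rank is [k]. *)
have -> : S = (D *m D^t*) *m ((s ^+ 2)^-1%:C *: S).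
  rewrite -scalemxAr DsW gramZ -scalemxAl scalerA -rmorphM mulVf ?expf_neq0 //.
  by rewrite rmorph1 scale1r mulmxDr -!scalemxAr QQ QJ1.
by rewrite -mulmxA mxrankM_maxl.
Qed.

End Nonneg.

End SingularValues.

(** * The bound and the equality criterion assembled *)

Theorem theorem23 (R : realType) (m n k : nat)
    (k_ge1 : (1 <= k)%N) (le_km : (k <= m)%N) (le_mn : (m <= n)%N)
    (A : 'M[R[i]]_(m, n)) (A_ge0 : forall i j, 0 <= A i j) :
  ky_fan_norm k A
    <= 1 / 2 * (1 + Num.sqrt k%:R) * Num.sqrt (m * n)%:R * max_norm A
  /\ (A != 0 ->
      (ky_fan_norm k A
         = 1 / 2 * (1 + Num.sqrt k%:R) * Num.sqrt (m * n)%:R * max_norm A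
       <->
       (exists (c : R[i]) (B : 'M[R[i]]_(m, n)),
          zero_one_mx B /\ A = c *: B)
       /\ (let D := 2 *: A - (max_norm A)%:C *: all_ones m n in
           plain D
           /\ has_exactly_k_nonzero_singular_values k D
           /\ nonzero_singular_values_equal D))).
Proof.
split; first exact: ky_fan_le.
move=> A0; split=> [kyE | [mult [Dplain [Dk Deq]]]].
  have [H Dprops] := ky_fan_eq_shift A_ge0 A0 k_ge1 le_km kyE.
  by split=> //; exact/(zero_one_multipleP A_ge0 A0).
have H := (zero_one_multipleP A_ge0 A0).1 mult.
exact: (ky_fan_eq_of_plain A_ge0 A0 k_ge1 le_km H Dplain Dk Deq).
Qed.
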